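(* There exist functions $\delta_1,\delta_2:\mathbb{N}\to\mathbb{R}_{\geq 0}$ with $\delta_1(n)\to 0$ and $\delta_2(n)\to 0$ as $n\to\infty$ such that for every $n\in\mathbb{N}$ there is a polytope with at most $n$ vertices, dimension at most $n^{\delta_1(n)}$, and extension complexity at least $n^{1-\delta_2(n)}$. (That is: a polytope with at most $n$ vertices, dimension $n^{o(1)}$ and extension complexity $n^{1-o(1)}$.)
   Context: The extension complexity $\operatorname{xc}(P)$ of a polytope $P$ is the minimum number of facets of a polytope $P'$ (in any dimension) such that $P$ is the image of $P'$ under a linear projection. Note $\operatorname{xc}(P)$ is always at most the number of vertices of $P$. *)

(* Defs.v *)
From HB Require Import structures.
From mathcomp Require Import all_boot all_order all_algebra.
From mathcomp Require Import all_classical all_reals all_analysis.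

Set Implicit Arguments.
Unset Strict Implicit.
Unset Printing Implicit Defensive.

Import Order.TTheory GRing.Theory Num.Theory.
Import numFieldNormedType.Exports.

Local Open Scope classical_set_scope.
Local Open Scope card_scope.
Local Open Scope ring_scope.

Definition convex_hull (R : realType) (d k : nat) (p : 'I_k -> 'rV[R]_d) :
    set 'rV[R]_d :=
  [set x | exists2 w : 'I_k -> R,
     (forall i, 0 <= w i) /\ \sum_i w i = 1 & x = \sum_i w i *: p i].

(* The empty set is a polytope (k = 0). *)
Definition polytope (R : realType) (d : nat) (P : set 'rV[R]_d) : Prop :=
  exists (k : nat) (p : 'I_k -> 'rV[R]_d), P = convex_hull p.

Definition affinely_independent (R : realType) (d m : nat)
    (p : 'I_m -> 'rV[R]_d) : Prop :=
  forall a : 'I_m -> R,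
    \sum_i a i = 0 -> \sum_i a i *: p i = 0 -> forall i, a i = 0.

(* The bound m <= d + 1 loses nothing: at most d + 1 points of R^d are
   affinely independent. *)
Definition affine_rank (R : realType) (d : nat) (A : set 'rV[R]_d) : nat :=
  \max_(m < d.+2 | `[< exists p : 'I_m -> 'rV[R]_d,
                         (forall i, A (p i)) /\ affinely_independent p >]) m.

(* Dimension of the affine hull; the empty set has dimension -1. *)
Definition affine_dim (R : realType) (d : nat) (A : set 'rV[R]_d) : int :=
  (affine_rank A)%:Z - 1.

(* P itself (c = 0, b = 0) and the empty set (c = 0, b = 1) are faces. *)
Definition face (R : realType) (d : nat) (P F : set 'rV[R]_d) : Prop :=
  exists (c : 'rV[R]_d) (b : R),
    (forall x, P x -> \sum_i c 0 i * x 0 i <= b) /\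
    F = P `&` [set x : 'rV[R]_d | \sum_i c 0 i * x 0 i = b].

Definition vertices (R : realType) (d : nat) (P : set 'rV[R]_d) :
    set 'rV[R]_d :=
  [set v | face P [set v]].

(* The empty face has dimension -1, so a single point has exactly one facet;
   this is what makes xc(P) = 1 for a point P. *)
Definition facets (R : realType) (d : nat) (P : set 'rV[R]_d) :
    set (set 'rV[R]_d) :=
  [set F | face P F /\ affine_dim F = affine_dim P - 1].

Definition has_extension (R : realType) (d : nat) (P : set 'rV[R]_d)
    (m : nat) : Prop :=
  exists (e : nat) (Q : set 'rV[R]_e) (f : {linear 'rV[R]_e -> 'rV[R]_d}),
    [/\ polytope Q, f @` Q = P & facets Q #= `I_m].

(* The default value 0 is never used for a polytope, which is an extension of
   itself with finitely many facets. *)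
Definition xc (R : realType) (d : nat) (P : set 'rV[R]_d) : nat :=
  if pselect (exists m, `[< has_extension P m >]) is left exm
  then ex_minn exm else 0%N.

(* Main.v *)
(* Identify a word [a] in [q]^m with its 0/1 one-hot vector [y], and let P be the
   convex hull of the q^m matrices [y y^T], which live in dimension (qm)^2.
   For every tuple [b] of m subsets of [q], the inequality
   (#{i | a_i in b_i} - 1)^2 >= 0 is linear in [y y^T], hence valid on P, and
   its slack pattern is that of unique disjointness over a large alphabet.
   An extension of P with r facets yields r rectangles of pairs (a, b) which
   cover all disjoint pairs and avoid those with exactly one agreement.  By an
   induction on m in the style of Kaibel and Weltge, for q = 2^k such a
   rectangle has at most ((k + 1) 2^q)^m disjoint pairs, out of
   (q 2^(q - 1))^m, so that r >= (q / (2 (k + 1)))^m.  It remains to let k and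
   m grow with n, here k = s^2 and m = (log n) / k with s = log log n. *)

Require Import Defs.
From mathcomp Require Import all_boot zify.
Set Implicit Arguments.
Unset Strict Implicit.
Unset Printing Implicit Defensive.

(** * Disjoint pairs in rectangles without unique agreement *)

Section Counting.
Variable q : nat.
Local Notation X := 'I_q.
Local Notation Y := {set 'I_q}.

Definition agree m (a : m.-tuple X) (b : m.-tuple Y) : nat :=
  \sum_(i < m) (tnth a i \in tnth b i).

Lemma agree_cons m x (a : m.-tuple X) y (b : m.-tuple Y) :
  agree (cons_tuple x a) (cons_tuple y b) = (x \in y) + agree a b.
Proof.
rewrite /agree big_ord_recl !tnth0; congr (_ + _).
by apply: eq_bigr => i _; rewrite !tnthS.
Qed.

Lemma big_tuple_cons (T : finType) m (F : m.+1.-tuple T -> nat) :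
  \sum_t F t = \sum_(t : m.-tuple T) \sum_x F (cons_tuple x t).
Proof.
rewrite pair_big /= (reindex (fun p : m.-tuple T * T => cons_tuple p.2 p.1)) //=.
exists (fun t : m.+1.-tuple T => (behead_tuple t, thead t)) => [[t x] _|t _] /=.
  by rewrite theadE; congr (_, _); apply: val_inj.
by rewrite [RHS]tuple_eta.
Qed.

Definition disjoint_pairs m (A : pred (m.-tuple X)) (B : pred (m.-tuple Y)) :=
  \sum_a \sum_b [&& A a, B b & agree a b == 0].

(** Grouping the pairs by their tails isolates the first coordinate; both inductions on [m] peel it
    off in this form. *)
Lemma disjoint_pairs_cons m (A : pred (m.+1.-tuple X)) B :
  disjoint_pairs A B = \sum_(a : m.-tuple X) \sum_(b : m.-tuple Y)
    (agree a b == 0) * \sum_x \sum_y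
      [&& A (cons_tuple x a), B (cons_tuple y b) & x \notin y].
Proof.
rewrite /disjoint_pairs big_tuple_cons; apply: eq_bigr => a _.
under eq_bigr do rewrite big_tuple_cons.
rewrite exchange_big; apply: eq_bigr => b _ /=.
rewrite big_distrr; apply: eq_bigr => x _; rewrite big_distrr /=.
apply: eq_bigr => y _; rewrite agree_cons addn_eq0 eqb0.
by case: (A _) (B _) (x \in y) (agree a b == 0) => [] [] [] [].
Qed.

Lemma sum_nat_bool (T : finType) (P : pred T) : \sum_x P x = #|[set x | P x]|.
Proof. by rewrite -big_mkcond sum1_card cardsE. Qed.

Lemma card_disjoint (U : {set X}) :
  #|[set y : Y | [disjoint U & y]]| = 2 ^ (q - #|U|).
Proof.
have -> : [set y : Y | [disjoint U & y]] = powerset (~: U).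
  by apply/setP => y; rewrite !inE disjoint_sym disjoints_subset.
by rewrite card_powerset cardsCs setCK card_ord.
Qed.

(** Each coordinate has [q] letters, and [2 ^ q.-1] subsets avoid a given letter. *)
Lemma disjoint_pairs_all m :
  @disjoint_pairs m predT predT = (q * 2 ^ q.-1) ^ m.
Proof.
elim: m => [|m IHm].
  rewrite /disjoint_pairs expn0.
  rewrite (eq_bigr (fun=> 1)) => [|a _]; first by rewrite sum1_card card_tuple.
  rewrite (eq_bigr (fun=> 1)) => [|b _]; first by rewrite sum1_card card_tuple.
  by rewrite /agree big_ord0.
rewrite disjoint_pairs_cons expnS -IHm /disjoint_pairs big_distrr.
apply: eq_bigr => a _ /=; rewrite big_distrr; apply: eq_bigr => b _ /=.
rewrite mulnC; congr (_ * _).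
under eq_bigr => x _.
  rewrite sum_nat_bool (_ : finset _ = [set y : Y | [disjoint [set x] & y]]).
    by rewrite card_disjoint cards1 subn1; over.
  by apply/setP => y; rewrite !inE disjoints1.
by rewrite sum_nat_const card_ord.
Qed.

(* Kaibel and Weltge's induction for unique disjointness.  Fixing all but the
   first coordinate leaves a product [U * V] of mutually disjoint pairs, so
   [#|V| <= 2 ^ (q - #|U|)]; the pairs are therefore charged either to [V],
   if [#|U| <= u], or to [U]. *)
Lemma disjoint_pairs_le u m (A : pred (m.-tuple X)) (B : pred (m.-tuple Y)) :
  (forall a b, A a -> B b -> agree a b != 1) ->
  disjoint_pairs A B <= (u * 2 ^ q + q * 2 ^ (q - u)) ^ m.
Proof.
elim: m A B => [|m IHm] A B AB.
  rewrite expn0 /disjoint_pairs.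
  apply: (@leq_trans (\sum_(a : 0.-tuple X) 1)).
    apply: leq_sum => a _; apply: (@leq_trans (\sum_(b : 0.-tuple Y) 1)).
      by apply: leq_sum => b _; case: [&& _, _ & _].
    by rewrite sum1_card card_tuple.
  by rewrite sum1_card card_tuple.
(* Fix a head [x] (or a head set [y]) and keep the tails whose partner has some head not agreeing
   with it. Prepending such heads does not change the agreement count, so these smaller rectangles
   still avoid the value 1. *)
pose Ax x := [pred a : m.-tuple X | A (cons_tuple x a)].
pose Bx x := [pred b : m.-tuple Y |
  [exists y : Y, (x \notin y) && B (cons_tuple y b)]].
pose Ay (y : Y) := [pred a : m.-tuple X |
  [exists x, (x \notin y) && A (cons_tuple x a)]].
pose By y := [pred b : m.-tuple Y | B (cons_tuple y b)].
have le_x x : disjoint_pairs (Ax x) (Bx x) <=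
    (u * 2 ^ q + q * 2 ^ (q - u)) ^ m.
  apply: IHm => a b /= Aa /existsP[y /andP[xy Bb]].
  by have := AB _ _ Aa Bb; rewrite agree_cons (negPf xy).
have le_y y : disjoint_pairs (Ay y) (By y) <=
    (u * 2 ^ q + q * 2 ^ (q - u)) ^ m.
  apply: IHm => a b /= /existsP[x /andP[xy Aa]] Bb.
  by have := AB _ _ Aa Bb; rewrite agree_cons (negPf xy).
apply: (@leq_trans (u * (\sum_y disjoint_pairs (Ay y) (By y)) +
                    2 ^ (q - u) * \sum_x disjoint_pairs (Ax x) (Bx x))).
  rewrite disjoint_pairs_cons /disjoint_pairs.
  have pull (T : finType) (F : T -> m.-tuple X -> m.-tuple Y -> nat) :
      \sum_t \sum_a \sum_b F t a b = \sum_a \sum_b \sum_t F t a b.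
    by rewrite exchange_big; apply: eq_bigr => a _; rewrite exchange_big.
  rewrite !pull !big_distrr -big_split; apply: leq_sum => a _ /=.
  rewrite !big_distrr -big_split; apply: leq_sum => b _ /=.
  have [ab|] := eqVneq (agree a b) 0; last by rewrite mul0n.
  rewrite mul1n.
  set U := [set x | A (cons_tuple x a)].
  set V := [set y | B (cons_tuple y b)].
  (* The tails being disjoint, an agreement of the heads would be the only one. *)
  have UV x y : x \in U -> y \in V -> x \notin y.
    rewrite !inE => Ax' By'; have := AB _ _ Ax' By'.
    by rewrite agree_cons ab; case: (x \in y).
  have -> : \sum_x \sum_y
      [&& A (cons_tuple x a), B (cons_tuple y b) & x \notin y] = #|U| * #|V|.
    rewrite -sum_nat_const [RHS]big_mkcond; apply: eq_bigr => x _.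
    case: ifPn => [xU|]; last by rewrite inE => /negPf->; rewrite big1.
    rewrite sum_nat_bool; apply: eq_card => y; rewrite !inE.
    apply/and3P/idP => [[]//|yV]; split=> //; first by rewrite inE in xU.
    by apply: UV xU _; rewrite inE.
  (* A member of [U] certifies that [a] is in [Ay y] for all [y] in [V]; a member of [V] does the
     same for [b] and [Bx]. *)
  have [->|[x0 x0U]] := set_0Vmem U; first by rewrite cards0 mul0n.
  have [->|[y0 y0V]] := set_0Vmem V; first by rewrite cards0 muln0.
  have leV : #|V| <= \sum_y [&& Ay y a, By y b & true].
    rewrite sum_nat_bool; apply/subset_leq_card/subsetP => y yV.
    rewrite !inE andbT; apply/andP; split; last by rewrite inE in yV.
    apply/existsP; exists x0; rewrite UV //=; by rewrite inE in x0U.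
  have leU : #|U| <= \sum_x [&& Ax x a, Bx x b & true].
    rewrite sum_nat_bool; apply/subset_leq_card/subsetP => x xU.
    rewrite !inE andbT; apply/andP; split; first by rewrite inE in xU.
    apply/existsP; exists y0; rewrite UV //=; by rewrite inE in y0V.
  apply: leq_trans (leq_add (leq_mul (leqnn u) leV)
                            (leq_mul (leqnn (2 ^ (q - u))) leU)).
  have [Uu|uU] := leqP #|U| u; first by rewrite -[leqLHS]addn0 leq_add ?leq_mul.
  rewrite -[leqLHS]add0n leq_add // mulnC leq_mul //.
  apply: (@leq_trans (2 ^ (q - #|U|))); last first.
    by rewrite leq_pexp2l // leq_sub2l // ltnW.
  rewrite -card_disjoint; apply/subset_leq_card/subsetP => y yV; rewrite inE.
  by apply/pred0P => x /=; apply/negP => /andP[/UV/(_ yV)/negP].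
rewrite expnS; set C := (_ ^ m)%N in le_x le_y *; rewrite mulnDl leq_add //.
  have <- : #|{: Y}| = 2 ^ q.
    by rewrite -cardsT -powersetT card_powerset cardsT card_ord.
  by rewrite -mulnA leq_mul // -sum_nat_const leq_sum.
rewrite (mulnC q) -mulnA leq_mul //.
apply: (@leq_trans (\sum_(x : X) C)); first exact: leq_sum.
by rewrite sum_nat_const card_ord.
Qed.

End Counting.

From mathcomp Require Import all_boot all_order all_algebra.
From mathcomp Require Import all_classical all_reals all_analysis.
From mathcomp Require Import ring lra.
Import Order.TTheory GRing.Theory Num.Theory.
Import numFieldNormedType.Exports.
Local Open Scope classical_set_scope.
Local Open Scope card_scope.
Local Open Scope ring_scope.

(** * Affine rank in homogeneous coordinates *)

Section AffineRank.
Variables (R : realType) (d : nat).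
Implicit Types (x y : 'rV[R]_d) (h : 'cV[R]_(d + 1)) (A : set 'rV[R]_d).

(** Appending a 1 turns affine dependence into linear dependence, and affine functionals into
    columns, evaluated by [evalh]. *)
Definition homog x : 'rV[R]_(d + 1) := row_mx x 1%:M.

Definition homog_mx m (p : 'I_m -> 'rV[R]_d) : 'M[R]_(m, d + 1) :=
  \matrix_i homog (p i).

Definition evalh h x : R := (homog x *m h) 0 0.

Lemma evalhD h g x : evalh (h + g) x = evalh h x + evalh g x.
Proof. by rewrite /evalh mulmxDr mxE. Qed.

Lemma evalhZ t h x : evalh (t *: h) x = t * evalh h x.
Proof. by rewrite /evalh -scalemxAr mxE. Qed.

Lemma dot_mulmx (c x : 'rV[R]_d) : \sum_i c 0 i * x 0 i = (x *m c^T) 0 0.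
Proof. by rewrite mxE; apply: eq_bigr => i _; rewrite mxE mulrC. Qed.

(** This column is the slack of the inequality [c x <= b]; with it, faces become zero sets of
    nonnegative functionals. *)
Lemma evalh_col (c : 'rV[R]_d) (b : R) x :
  evalh (col_mx (- c^T) b%:M) x = b - \sum_i c 0 i * x 0 i.
Proof.
rewrite /evalh mul_row_col mul1mx mulmxN dot_mulmx [LHS]mxE addrC.
by congr (_ + _); rewrite mxE ?eqxx ?mulr1n.
Qed.

Lemma homog_sum k (w : 'I_k -> R) (p : 'I_k -> 'rV[R]_d) :
  \sum_i w i *: homog (p i) = row_mx (\sum_i w i *: p i) (\sum_i w i)%:M.
Proof.
rewrite -[LHS]hsubmxK; congr row_mx.
  rewrite linear_sum; apply: eq_bigr => i _.
  by rewrite linearZ /= row_mxKl.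
rewrite linear_sum raddf_sum; apply: eq_bigr => i _.
by rewrite linearZ /= row_mxKr scale_scalar_mx mulr1.
Qed.

Lemma evalh_comb h k (w : 'I_k -> R) (p : 'I_k -> 'rV[R]_d) :
  \sum_i w i = 1 ->
  evalh h (\sum_i w i *: p i) = \sum_i w i * evalh h (p i).
Proof.
move=> w1; rewrite /evalh /homog -[in LHS]w1 -homog_sum mulmx_suml summxE.
by apply: eq_bigr => i _; rewrite -scalemxAl mxE.
Qed.

Lemma affinely_independentE m (p : 'I_m -> 'rV[R]_d) :
  affinely_independent p <-> row_free (homog_mx p).
Proof.
have E (v : 'rV_m) : v *m homog_mx p =
    row_mx (\sum_i v 0 i *: p i) (\sum_i v 0 i)%:M.
  rewrite mulmx_sum_row -homog_sum.
  by apply: eq_bigr => i _; rewrite rowK.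
split=> [pI | pF a a0 ap0 i].
  apply: inj_row_free => v; rewrite E => /eqP; rewrite row_mx_eq0.
  case/andP=> /eqP vp0 /eqP/matrixP/(_ 0 0); rewrite !mxE eqxx mulr1n => v0.
  by apply/rowP => i; rewrite (pI _ v0 vp0) mxE.
have /(row_free_inj pF) : (\row_i a i) *m homog_mx p = 0 *m homog_mx p.
  rewrite mul0mx E; under eq_bigr do rewrite mxE.
  under [in X in row_mx _ X]eq_bigr do rewrite mxE.
  by rewrite a0 ap0 raddf0 row_mx0.
by move/rowP/(_ i); rewrite !mxE.
Qed.

Lemma affine_rank_ge A m (p : 'I_m -> 'rV[R]_d) :
  (forall i, A (p i)) -> row_free (homog_mx p) -> (m <= affine_rank A)%N.
Proof.
move=> Ap pF; have md : (m < d.+2)%N.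
  by have := rank_leq_col (homog_mx p); rewrite (eqP pF) addn1.
apply: (bigop.bigmax_sup (Ordinal md)) => //.
by apply/asboolP; exists p; rewrite affinely_independentE.
Qed.

Lemma row_free_homog_rcons m (p : 'I_m -> 'rV[R]_d) x :
  row_free (homog_mx p) -> ~~ (homog x <= homog_mx p)%MS ->
  row_free (homog_mx (fun i : 'I_(m + 1) =>
    if fintype.split i is inl j then p j else x)).
Proof.
move=> pF xp.
rewrite (_ : homog_mx _ = col_mx (homog_mx p) (homog x)); last first.
  apply/row_matrixP => i; rewrite rowK -{2}[i]splitK.
  case: (fintype.split i) => j /=; first by rewrite rowKu rowK.
  by rewrite rowKd row_id.
have lt : (homog_mx p < col_mx (homog_mx p) (homog x))%MS.
  by rewrite ltmxE -{1}addsmxE addsmxSl col_mx_sub submx_refl.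
rewrite /row_free eqn_leq rank_leq_row.
by apply: leq_trans (rank_ltmx lt); rewrite (eqP pF) addn1.
Qed.

(** A largest affinely independent family spans, since a point outside its span could be
    appended. *)
Lemma affine_rank_basis A :
  exists p : 'I_(affine_rank A) -> 'rV[R]_d,
    [/\ forall i, A (p i), row_free (homog_mx p) &
        forall x, A x -> (homog x <= homog_mx p)%MS].
Proof.
have [p [Ap pF]] : exists p : 'I_(affine_rank A) -> 'rV[R]_d,
    (forall i, A (p i)) /\ row_free (homog_mx p).
  pose P (m : 'I_d.+2) := `[< exists p : 'I_m -> 'rV[R]_d,
    (forall i, A (p i)) /\ affinely_independent p >].
  (* The empty family is a candidate, so the maximum is attained. *)
  have P0 : (0 < #|P|)%N.
    apply/card_gt0P; exists ord0; apply/asboolP.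
    by exists (fun=> 0); split=> [[]|? _ _ []].
  have [m] := eq_bigmax_cond (@nat_of_ord d.+2) P0;
    rewrite -[\max_(i in P) i]/(affine_rank A) => + ->.
  by move=> /asboolP[p [Ap /affinely_independentE pI]]; exists p.
exists p; split=> // x Ax; apply/negPn/negP => xp.
have /(_ A) := affine_rank_ge _ (row_free_homog_rcons pF xp).
suff Ap' : forall i, A (if fintype.split i is inl j then p j else x).
  by move=> /(_ (Ap' 1%N)); rewrite -{2}[affine_rank A]addn0 leq_add2l.
by move=> ? i; case: fintype.split.
Qed.

End AffineRank.

(** * Faces and facets *)

Section Polytopes.
Variables (R : realType) (d : nat).
Implicit Types (x y : 'rV[R]_d) (h : 'cV[R]_(d + 1)) (P F G : set 'rV[R]_d).

Lemma convex_hull_gen k (p : 'I_k -> 'rV[R]_d) i : convex_hull p (p i).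
Proof.
exists (fun j => (j == i)%:R); first split=> [j|]; first by rewrite ler0n.
  by rewrite (bigD1 i) //= eqxx big1 ?addr0 // => j /negPf->.
rewrite (bigD1 i) //= eqxx scale1r big1 ?addr0 // => j /negPf->.
by rewrite scale0r.
Qed.

Lemma face_subset P F : face P F -> F `<=` P.
Proof. by move=> [c [b [_ ->]]] x []. Qed.

Lemma face_evalh P F : face P F ->
  exists2 h, (forall x, P x -> 0 <= evalh h x) &
    F = P `&` [set x | evalh h x = 0].
Proof.
move=> [c [b [cb ->]]]; exists (col_mx (- c^T) b%:M) => [x Px|].
  by rewrite evalh_col subr_ge0 cb.
congr (_ `&` _); apply/seteqP; split=> x /=; rewrite evalh_col.
  by move=> ->; rewrite subrr.
by move/eqP; rewrite subr_eq0 => /eqP.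
Qed.

Lemma evalh_face k (p : 'I_k -> 'rV[R]_d) h :
  (forall i, 0 <= evalh h (p i)) ->
  face (convex_hull p) (convex_hull p `&` [set x | evalh h x = 0]).
Proof.
move=> h0.
have hE x : evalh h x = dsubmx h 0 0 - \sum_i (- usubmx h)^T 0 i * x 0 i.
  rewrite -evalh_col trmxK opprK -mx11_scalar vsubmxK //.
exists (- usubmx h)^T, (dsubmx h 0 0); split=> [x [w [w0 w1] ->]|].
  rewrite -subr_ge0 -hE evalh_comb //.
  by apply: sumr_ge0 => i _; rewrite mulr_ge0.
congr (_ `&` _); apply/seteqP; split=> x /=; rewrite hE.
  by move/eqP; rewrite subr_eq0 => /eqP.
by move=> ->; rewrite subrr.
Qed.

(** A nonnegative functional vanishes at a convex combination only if it vanishes at every point of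
    positive weight. *)
Lemma face_hullP k (p : 'I_k -> 'rV[R]_d) F x : face (convex_hull p) F ->
  F x <-> exists w : 'I_k -> R, [/\ forall i, 0 <= w i, \sum_i w i = 1,
    x = \sum_i w i *: p i & forall i, w i != 0 -> F (p i)].
Proof.
move=> /face_evalh[h h0 ->]; split=> [[[w [w0 w1] ->] /=]|].
  rewrite evalh_comb // => /eqP; rewrite psumr_eq0; last first.
    by move=> i _; rewrite mulr_ge0 // h0 //; apply: convex_hull_gen.
  move=> /allP wh; exists w; split=> // i wi; split=> /=.
    exact: convex_hull_gen.
  have := wh i; rewrite mem_index_enum mulf_eq0 (negPf wi) /= => /(_ isT).
  by move=> /eqP.
move=> [w [w0 w1 -> wF]]; split; first by exists w.
rewrite /= evalh_comb // big1 // => i _.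
have [->|/wF[_ /= ->]] := eqVneq (w i) 0; first by rewrite mul0r.
by rewrite mulr0.
Qed.

(** By [face_hullP], a face is determined by the generators it contains. *)
Lemma finite_facets P : polytope P -> finite_set (facets P).
Proof.
move=> [k [p ->]].
pose hullS (S : {set 'I_k}) := [set x | exists w : 'I_k -> R,
  [/\ forall i, 0 <= w i, \sum_i w i = 1,
    x = \sum_i w i *: p i & forall i, w i != 0 -> i \in S]].
apply: (@sub_finite_set _ _ (hullS @` setT)); last first.
  exact/finite_image/finite_finset.
move=> F [Ff _]; exists [set i | `[< F (p i) >]]%SET => //.
apply/seteqP; split=> x; rewrite (face_hullP _ Ff) => -[w [w0 w1 -> wF]].
  by exists w; split=> // i /wF; rewrite inE => /asboolP.
by exists w; split=> // i /wF Fi; rewrite inE; apply/asboolP.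
Qed.

(** Every generator of positive weight in a vertex equals that vertex. *)
Lemma vertices_card k (p : 'I_k -> 'rV[R]_d) :
  vertices (convex_hull p) #<= `I_k.
Proof.
apply: (@card_le_trans _ _ _ (p @` setT)).
  apply: subset_card_le => v vf; have : [set v] v by [].
  rewrite (face_hullP _ vf) => -[w [w0 w1 _ wv]].
  have [i wi] : exists i, w i != 0.
    apply/existsP; rewrite -negb_forall; apply/negP => /forallP w00.
    by move/eqP: w1; rewrite big1 ?[0 == _]eq_sym ?oner_eq0 // => i _; apply/eqP.
  by exists i => //; apply: wv wi.
apply: card_le_trans (card_image_le _ _) _.
by rewrite (card_le_eqr card_II).
Qed.

(* Among the faces containing [G] but not [x], a maximal one is a facet: if
   its codimension were larger, some affine functional would vanish on it and
   at [x] but not on the polytope, and tilting the supporting functional along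
   it would enlarge the face. *)
Lemma facet_separation P G x : polytope P -> face P G -> P x -> ~ G x ->
  exists F, [/\ facets P F, G `<=` F & ~ F x].
Proof.
move=> [k [p ->]]; set Q := convex_hull p => GQ Qx Gx.
(* Maximality of the face is measured by the number of generators at which its functional
   vanishes. *)
pose good h := [/\ forall i, 0 <= evalh h (p i),
  forall y, G y -> evalh h y = 0 & 0 < evalh h x].
pose zeros h : {set 'I_k} := [set i | evalh h (p i) == 0]%SET.
pose szs (j : nat) := `[< exists2 h, good h & #|zeros h| = j >].
have szs_ex : exists j, szs j.
  have [h h0 GE] := face_evalh GQ; exists #|zeros h|; apply/asboolP.
  exists h => //; split=> [i|y|]; first exact/h0/convex_hull_gen.
    by rewrite GE => -[].
  rewrite lt_def h0 // andbT; apply/eqP => hx0; apply: Gx.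
  by rewrite GE.
have szs_le j : szs j -> (j <= k)%N.
  by move=> /asboolP[h _ <-]; rewrite -[X in (_ <= X)%N]card_ord max_card.
case: (ex_maxnP szs_ex szs_le) => j /asboolP[h [h0 hG hx] hj] hmax.
pose F := Q `&` [set y | evalh h y = 0].
have FQ : face Q F by exact: evalh_face.
have GF : G `<=` F by move=> y Gy; split; [exact: face_subset Gy|exact: hG].
have Fx : ~ F x by move=> [_ /= hx0]; rewrite hx0 ltxx in hx.
exists F; split=> //; split=> //.
have [f [Ff frow Fspan]] := affine_rank_basis F.
have xf : ~~ (homog x <= homog_mx f)%MS.
  apply/negP => /submxP[a xa]; move: hx.
  rewrite /evalh xa -mulmxA (_ : homog_mx f *m h = 0) ?mulmx0 ?mxE ?ltxx //.
  apply/row_matrixP => i; rewrite row_mul rowK row0.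
  by apply/matrixP => ? ?; rewrite !ord1 [RHS]mxE; case: (Ff i).
have := row_free_homog_rcons frow xf; set f' := fun _ => _ => f'row.
have f'Q i : Q (f' i).
  by rewrite /f'; case: fintype.split => // l; have [] := Ff l.
have rge := affine_rank_ge f'Q f'row.
suff rle : (affine_rank Q <= affine_rank F + 1)%N.
  by rewrite /affine_dim (_ : affine_rank Q = affine_rank F + 1)%N; lia.
rewrite leqNgt; apply/negP => rgt.
(* If the codimension exceeds 1, a basis of [F] together with [x] cannot span [Q], so some generator
   escapes its span. *)
have [i0 pi0] : exists i, ~~ (homog (p i) <= homog_mx f')%MS.
  apply/existsP; rewrite -negb_forall; apply/negP => /forallP pf'.
  have [g [Qg grow _]] := affine_rank_basis Q.
  move: rgt; rewrite ltnNge => /negP; apply.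
  rewrite -(eqP grow); apply: leq_trans (rank_leq_row (homog_mx f')).
  apply: mxrankS; apply/row_subP => i; rewrite rowK.
  have [w [w0 w1] ->] := Qg i.
  rewrite /homog -[in row_mx _ _]w1 -homog_sum; apply: summx_sub => l _.
  exact: scalemx_sub.
have [g gf' gi0] : exists2 g : 'cV[R]_(d + 1),
    forall i, evalh g (f' i) = 0 & evalh g (p i0) < 0.
  move: pi0; rewrite submxE => /rV0Pn[l].
  set C := cokermx _; set v := _ *m C => vl.
  have colC y : evalh (col l C) y = (homog y *m C) 0 l.
    by rewrite /evalh colE mulmxA -colE mxE.
  (* A cokernel column vanishes on the span; the scaling makes its value at [p i0] minus a nonzero
     square. *)
  exists (- v 0 l *: col l C) => [i|]; rewrite evalhZ colC.
    have /matrixP/(_ i l) : homog_mx f' *m C = 0 by exact: mulmx_coker.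
    have <- : row i (homog_mx f' *m C) 0 l = (homog_mx f' *m C) i l.
      by rewrite [LHS]mxE.
    by rewrite row_mul rowK => ->; rewrite [X in _ * X]mxE mulr0.
  by rewrite -/v mulNr oppr_lt0 -expr2 exprn_even_gt0.
have gf i : evalh g (f i) = 0.
  by rewrite -(gf' (lshift 1 i)) /f' (unsplitK (inl i)).
have gF y : F y -> evalh g y = 0.
  move=> /Fspan/submxP[a ya].
  rewrite /evalh ya -mulmxA (_ : homog_mx f *m g = 0) ?mulmx0 ?mxE //.
  apply/row_matrixP => i; rewrite row_mul rowK row0.
  by apply/matrixP => ? ?; rewrite !ord1 [RHS]mxE; exact: gf.
have gx : evalh g x = 0.
  by rewrite -(gf' (rshift _ 0)) /f' (unsplitK (inr 0)).
(* Where [g] is negative, [t i] is the tilt at which [h + t i *: g] vanishes at [p i]. The least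
   such tilt keeps all generators nonnegative. *)
pose t i := evalh h (p i) / - evalh g (p i).
case: (arg_minP (P := fun i => evalh g (p i) < 0) t gi0) => i1 gi1 tmin.
have hi1 : 0 < evalh h (p i1).
  rewrite lt_def h0 andbT; apply/eqP => hi1; move: gi1.
  by rewrite gF ?ltxx //; split=> //; apply: convex_hull_gen.
have t0 : 0 < t i1 by rewrite divr_gt0 // oppr_gt0.
pose h' := h + t i1 *: g.
have hh' y : evalh h' y = evalh h y + t i1 * evalh g y.
  by rewrite evalhD evalhZ.
have h'good : good h'.
  split=> [i|y Gy|]; last by rewrite hh' gx mulr0 addr0.
    rewrite hh'; have [gi|gi] := leP 0 (evalh g (p i)).
      by rewrite addr_ge0 // mulr_ge0 // ltW.
    by have := tmin _ gi; rewrite {2}/t ler_pdivlMr ?oppr_gt0 //; lra.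
  by rewrite hh' hG // gF ?mulr0 ?addr0 //; apply: GF.
have : (#|zeros h'| <= j)%N by apply: hmax; apply/asboolP; exists h'.
(* Old zeros lie in [F], where [g] vanishes, so they persist; [i1] is a new one. *)
rewrite leqNgt -hj => /negP; apply; apply: proper_card; apply/properP; split.
  apply/fintype.subsetP => i; rewrite !inE hh' => /eqP hi; rewrite hi gF ?mulr0 ?addr0 //.
  by split=> //; apply: convex_hull_gen.
exists i1; rewrite inE; last by rewrite gt_eqF.
by rewrite hh' /t invrN mulrN mulNr divfK ?subrr // lt_eqF.
Qed.

End Polytopes.

(** * Extension complexity *)

Section Extensions.
Variables (R : realType) (d : nat).

Lemma polytope_extension (P : set 'rV[R]_d) :
  polytope P -> exists r, has_extension P r.
Proof.
move=> Ppoly; have /finite_setP[r Pr] := finite_facets Ppoly.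
exists r, d, P, idfun; split=> //; exact: image_id.
Qed.

Lemma xc_extension (P : set 'rV[R]_d) : polytope P -> has_extension P (xc P).
Proof.
move=> /polytope_extension[r Pr]; rewrite /xc.
case: pselect => [exm|[]]; last by exists r; apply/asboolP.
by case: ex_minnP => ? /asboolP.
Qed.

(* The easy half of Yannakakis' theorem: facets of the extension cover the
   support of the slack matrix by combinatorial rectangles. *)
Lemma extension_rectangles (I J : Type) (P : set 'rV[R]_d) r
    (p : I -> 'rV[R]_d) (c : J -> 'rV[R]_d) (b : J -> R) :
  has_extension P r -> (forall i, P (p i)) ->
  (forall j x, P x -> \sum_l c j 0 l * x 0 l <= b j) ->
  exists (A : 'I_r -> set I) (B : 'I_r -> set J),
    (forall t i j, A t i -> B t j -> \sum_l c j 0 l * p i 0 l != b j) /\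
    (forall i j, \sum_l c j 0 l * p i 0 l != b j -> exists t, A t i /\ B t j).
Proof.
move=> [e [Q [f [Qpoly fQ Qr]]]] Pp cb.
have /choice[y yP] : forall i, exists y, Q y /\ f y = p i.
  by move=> i; have := Pp i; rewrite -fQ => -[y Qy <-]; exists y.
pose G j := Q `&` [set y | \sum_l c j 0 l * f y 0 l = b j].
have GQ j : face Q (G j).
  have cf (z : 'rV[R]_e) : \sum_l (lin1_mx f *m (c j)^T)^T 0 l * z 0 l =
              \sum_l c j 0 l * f z 0 l.
    by rewrite !dot_mulmx trmxK mulmxA mul_rV_lin1.
  exists (lin1_mx f *m (c j)^T)^T, (b j); split=> [z Qz|].
    by rewrite cf; apply: cb; rewrite -fQ; exists z.
  by congr (_ `&` _); apply/seteqP; split=> z /=; rewrite cf.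
have /pcard_surjP[F FQ] : facets Q #<= [set: 'I_r].
  by rewrite (card_le_eql Qr) -(card_le_eqr card_II).
(* The rectangle of a facet pairs the points whose lift avoids it with the inequalities whose tight
   face in [Q] lies inside it. *)
exists (fun t => [set i | ~ F t (y i)]), (fun t => [set j | G j `<=` F t]).
split=> [t i j /= Fi GF|i j ij].
  have [Qy fy] := yP i.
  by apply/eqP => ij; apply/Fi/GF; split=> //=; rewrite fy.
have [Qy fy] := yP i.
have [H [Hf GH Hy]] : exists F, [/\ facets Q F, G j `<=` F & ~ F (y i)].
  apply: facet_separation => // -[_ /=]; rewrite fy => /eqP.
  by rewrite (negPf ij).
by have [t _ tH] := FQ H Hf; exists t; rewrite /= tH.
Qed.

End Extensions.

(** * The polytope *)

Lemma affine_dim_le (R : realType) d (A : set 'rV[R]_d) :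
  (affine_dim A <= d%:Z)%R.
Proof.
have : (affine_rank A <= d.+1)%N by apply/bigop.bigmax_leqP => i _; rewrite -ltnS.
by rewrite /affine_dim; lia.
Qed.

Section HardPolytope.
Variables (R : realType) (q m : nat).
Local Notation X := 'I_q.
Local Notation Y := {set 'I_q}.
Local Notation J := ('I_m * 'I_q)%type.
Local Notation N := #|{: J * J}|.

Definition onehot (a : m.-tuple X) (j : J) : bool := tnth a j.1 == j.2.
Definition select (b : m.-tuple Y) (j : J) : bool := j.2 \in tnth b j.1.

Definition point (a : m.-tuple X) : 'rV[R]_N :=
  \row_l (onehot a (enum_val l).1 && onehot a (enum_val l).2)%:R.

(* Coefficients of [1 - (agree a b - 1) ^ 2] in the entries of [y y^T]; linear
   terms sit on the diagonal because [y j ^ 2 = y j]. *)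
Definition normal (b : m.-tuple Y) : 'rV[R]_N :=
  \row_l ((select b (enum_val l).1 && ((enum_val l).1 == (enum_val l).2))%:R *+ 2
    - (select b (enum_val l).1 && select b (enum_val l).2)%:R).

Lemma agree_sum a b : (agree a b)%:R = \sum_j (onehot a j && select b j)%:R :> R.
Proof.
rewrite /agree natr_sum -(pair_bigA _
  (fun i x => (onehot a (i, x) && select b (i, x))%:R)) /=.
apply: eq_bigr => i _; rewrite (bigD1 (tnth a i)) //= /onehot /select /= eqxx /=.
by rewrite big1 ?addr0 // => x /negPf; rewrite eq_sym => ->.
Qed.

(** Against the right-hand side 1, the slack is [(agree a b - 1) ^ 2]: zero exactly at a unique
    agreement, and 1 on disjoint pairs. *)
Lemma slackE a b :
  \sum_l normal b 0 l * point a 0 l = 1 - ((agree a b)%:R - 1) ^+ 2.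
Proof.
under eq_bigr do rewrite !mxE.
pose F (jj : J * J) : R := ((select b jj.1 && (jj.1 == jj.2))%:R *+ 2
    - (select b jj.1 && select b jj.2)%:R) * (onehot a jj.1 && onehot a jj.2)%:R.
rewrite -(big_enum_val F) /= -(pair_bigA _ (fun i j => F (i, j))) /= /F /=.
have -> : 1 - ((agree a b)%:R - 1) ^+ 2 =
    (agree a b)%:R *+ 2 - (agree a b)%:R ^+ 2 :> R by ring.
rewrite agree_sum expr2 mulr_suml -sumrMnl -sumrB; apply: eq_bigr => j _.
rewrite mulr_sumr (bigD1 j) //= eqxx andbT [in RHS](bigD1 j) //=.
rewrite opprD addrA -sumrN; congr (_ + _).
  by case: (onehot a j) (select b j) => [] [] /=; ring.
apply: eq_bigr => i; rewrite eq_sym => /negPf ->; rewrite andbF mul0rn sub0r.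
by case: (onehot a j) (select b j) (onehot a i) (select b i) => [] [] [] [] /=;
  ring.
Qed.

Definition point_hull : set 'rV[R]_N :=
  convex_hull (fun i : 'I_#|{: m.-tuple X}| => point (enum_val i)).

Lemma point_hull_point a : point_hull (point a).
Proof. by rewrite -(enum_rankK a); exact: convex_hull_gen. Qed.

Lemma point_hull_valid b x : point_hull x -> \sum_l normal b 0 l * x 0 l <= 1.
Proof.
move=> [w [w0 w1] ->].
under eq_bigr do rewrite summxE mulr_sumr.
rewrite exchange_big /= -[leRHS]w1; apply: ler_sum => i _.
under eq_bigr do rewrite [X in _ * X]mxE mulrCA.
rewrite -mulr_sumr slackE -[leRHS]mulr1 ler_wpM2l // gerBl.
exact: sqr_ge0.
Qed.

Lemma xc_point_hull u :
  ((q * 2 ^ q.-1) ^ m <=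
    xc point_hull * (u * 2 ^ q + q * 2 ^ (q - u)) ^ m)%N.
Proof.
have Ppoly : polytope point_hull by eexists; eexists.
have [A [B [AB cover]]] := extension_rectangles (xc_extension Ppoly)
  point_hull_point point_hull_valid.
pose A' t a := `[< A t a >]; pose B' t b := `[< B t b >].
rewrite -disjoint_pairs_all.
apply: (@leq_trans (\sum_(t < xc point_hull) disjoint_pairs (A' t) (B' t))%N).
  rewrite /disjoint_pairs [leqRHS]exchange_big; apply: leq_sum => a _ /=.
  rewrite [leqRHS]exchange_big; apply: leq_sum => b _ /=.
  have [ab|//] := eqVneq (agree a b) 0%N.
  have [|t [At Bt]] := cover a b.
    by rewrite slackE ab sub0r sqrrN expr1n subrr eq_sym oner_eq0.
  by rewrite (bigD1 t) //= /A' /B' (asboolT At) (asboolT Bt).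
rewrite -[in leqRHS](card_ord (xc point_hull)) -sum_nat_const.
apply: leq_sum => t _; apply: disjoint_pairs_le => a b /asboolP At /asboolP Bt.
apply: contraNneq (AB _ _ _ At Bt) => ab.
by rewrite slackE ab subrr expr0n subr0.
Qed.

End HardPolytope.

Lemma low_dim_high_xc (R : realType) (k m : nat) :
  exists (d : nat) (P : set 'rV[R]_d),
    [/\ polytope P, vertices P #<= `I_(2 ^ (k * m)),
        (affine_dim P <= ((m * 2 ^ k) ^ 2)%:Z)%R
      & (2 ^ (k * m) <= xc P * (2 * k.+1) ^ m)%N].
Proof.
pose q := (2 ^ k)%N; have q0 : (0 < q)%N by rewrite expn_gt0.
have kq : (k <= q)%N by rewrite ltnW // ltn_expl.
exists _, (@point_hull R q m); split.
- by eexists; eexists.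
- have -> : (2 ^ (k * m) = #|{: m.-tuple 'I_q}|)%N.
    by rewrite card_tuple card_ord -expnM.
  exact: vertices_card.
- apply: le_trans (affine_dim_le _) _.
  by rewrite !card_prod !card_ord.
(* The threshold [u = k] is the base 2 logarithm of [q], so that [q * 2 ^ (q - k)] is just
   [2 ^ q]. *)
have := xc_point_hull R q m k.
have -> : (k * 2 ^ q + q * 2 ^ (q - k) = k.+1 * 2 ^ q)%N.
  by rewrite {2}/q -expnD subnKC // mulSn addnC.
move=> H; rewrite -(@leq_pmul2r ((2 ^ q) ^ m)) ?expn_gt0 //.
apply: leq_trans (_ : (q * 2 ^ q.-1) ^ m * 2 ^ m <= _)%N.
  by rewrite expnM -!expnMn -mulnA -expnSr prednK.
apply: leq_trans (leq_mul H (leqnn _)) _.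
by rewrite !expnMn; lia.
Qed.

(** * Choice of the parameters *)

(** With [2 ^ s <= L], this yields the constant 16 of [delta], both for the dimension and for the
    complexity. *)
Lemma cubic_le_expn s : ((s + 1) * (s ^ 2 + s + 1) <= 8 * 2 ^ s)%N.
Proof.
case: s => [|[|[|[|s]]]] //; elim: s => [//|s IHs].
move: IHs; rewrite [(2 ^ s.+1.+4)%N]expnS; nia.
Qed.

Lemma square_le_expn s : (2 * (s ^ 2).+1 <= 2 ^ (s + 3))%N.
Proof.
case: s => [|[|s]] //; elim: s => [//|s IHs].
move: IHs; rewrite [(s.+3 + 3)%N]addSn [(2 ^ (s.+2 + 3).+1)%N]expnS; nia.
Qed.

(* The inequality [(L + 1) (1 - 16 / (s + 1)) <= k m - (s + 3) m], cleared of
   denominators; the factor [2 ^ (s + 3)] dominates [2 (k + 1)]. *)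
Lemma exponent_loss (L s k m : nat) : (0 < s)%N -> k = (s ^ 2)%N ->
  m = (L %/ k)%N -> (2 ^ s <= L)%N ->
  ((s + 1) * (L + 1) <= (s + 1) * (k * m - (s + 3) * m) + 16 * (L + 1))%N.
Proof.
move=> s0 kE mE sL; have k0 : (0 < k)%N by rewrite kE expn_gt0 s0.
have mkL : (m * k <= L)%N by rewrite mE leq_trunc_div.
have Lmk : (L < m * k + k)%N by rewrite addnC -mulSn mE ltn_ceil.
have cub := leq_trans (cubic_le_expn s) (leq_mul (leqnn 8) sL).
move: cub; rewrite -kE; rewrite -mulnn in kE => cub; clear mE sL.
(* Two losses of at most [8 * L] each: [h1] for rounding [m] down, [h3] for the factor
   [2 ^ ((s + 3) * m)]. *)
have h1 : ((s + 1) * k <= 8 * L)%N.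
  by apply: leq_trans cub; rewrite leq_mul2l -addnA leq_addr orbT.
have h2 : ((s + 1) * (s + 3) <= 8 * k)%N by nia.
have h3 : ((s + 1) * (s + 3) * m <= 8 * L)%N.
  by apply: leq_trans (leq_mul h2 (leqnn m)) _; rewrite -mulnA leq_mul2l mulnC.
have h4 : ((s + 1) * (L + 1) <= (s + 1) * (m * k) + (s + 1) * k)%N.
  by rewrite -mulnDr leq_mul // addn1.
rewrite mulnBr (mulnC k) mulnA.
move: h1 h3 h4; set a := (_ * k)%N; set b := (_ * m)%N; set c := (_ * (m * k))%N.
lia.
Qed.

(** * Bounds with real exponents *)

Section Exponents.
Variable R : realType.

Definition loglog n := trunc_log 2 (trunc_log 2 n).

(** As [harmonic] is shifted by one, this is [16 / (s + 1)] with [s = loglog n]. *)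
Definition delta (n : nat) : R := 16 * harmonic (loglog n).

Lemma delta_ge0 n : 0 <= delta n.
Proof. by rewrite mulr_ge0 // harmonic_ge0. Qed.

Lemma cvg_delta : delta @ \oo --> (0 : R).
Proof.
rewrite -(mulr0 16); apply: cvgM; first exact: cvg_cst.
apply: (@cvg_comp _ _ _ loglog (@harmonic R)); last exact: cvg_harmonic.
apply/cvgnyPge => N; exists (2 ^ 2 ^ N)%N => // n /= Nn.
rewrite /loglog -[N in leqLHS](@trunc_expnK 2) // leq_trunc_log //.
by rewrite -[(2 ^ N)%N in leqLHS](@trunc_expnK 2) // leq_trunc_log.
Qed.

Lemma dim_exponent n m : (m <= trunc_log 2 n)%N ->
  (((m * 2 ^ (loglog n ^ 2)) ^ 2)%:R <= n%:R `^ delta n :> R).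
Proof.
case: m => [|m]; first by rewrite mul0n powR_ge0.
set L := trunc_log 2 n; set s := loglog n => mL.
have L0 : (0 < L)%N by apply: leq_trans mL.
have sL : (2 ^ s <= L)%N by exact: trunc_logP.
have Ls : (L < 2 ^ s.+1)%N by exact: trunc_log_ltn.
have n0 : (0 < n)%N by case: n @L @s mL L0 sL Ls.
apply: le_trans (_ : ((2 ^ L)%:R : R) `^ delta n <= _); last first.
  rewrite ge0_ler_powR ?delta_ge0 ?nnegrE ?ler0n // ler_nat.
  exact: trunc_logP.
rewrite [in leRHS]natrX -powR_mulrn // -powRrM.
(* Here [m <= L < 2 ^ s.+1], so [m * 2 ^ (s ^ 2)] is at most [2 ^ (s ^ 2 + s + 1)]. *)
apply: (@le_trans _ _ (2 `^ (2 * (s ^ 2 + s + 1))%:R)).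
  rewrite powR_mulrn // -natrX ler_nat [(2 * _)%N]mulnC expnM leq_sqr.
  by rewrite -addnA expnD mulnC leq_mul // addn1 (leq_trans mL) // ltnW.
rewrite ler_powR ?ler1n // /delta /harmonic mulrA ler_pdivlMr ?ltr0n //.
rewrite -!natrM ler_nat -addn1; have := cubic_le_expn s; nia.
Qed.

Lemma xc_exponent n r k m : (0 < n)%N -> k = (loglog n ^ 2)%N ->
  m = (trunc_log 2 n %/ k)%N ->
  (2 ^ (k * m) <= r * (2 * k.+1) ^ m)%N ->
  n%:R `^ (1 - delta n) <= r%:R :> R.
Proof.
set L := trunc_log 2 n; set s := loglog n => n0 kE mE kr.
have r0 : (0 < r)%N by case: r kr => //; rewrite leqNgt expn_gt0.
(* For [delta n >= 1] the left side is at most 1. Otherwise [s] is positive, because [s = 0] gives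
   [delta n = 16]. *)
have [d1|d1] := leP 1 (delta n).
  apply: (@le_trans _ _ 1); last by rewrite ler1n.
  by rewrite -[leRHS](powRr0 n%:R) ler_powR ?ler1n // subr_le0.
have s0 : (0 < s)%N.
  rewrite lt0n; apply/eqP => s0; move: d1.
  by rewrite /delta -/s s0 /harmonic /= invr1 mulr1 ltrn1.
have L0 : (0 < L)%N by move: s0; rewrite /s /loglog -/L; case: (L).
have sL : (2 ^ s <= L)%N by exact: trunc_logP.
have nL : (n < 2 ^ L.+1)%N by exact: trunc_log_ltn.
(* The subtraction is truncated; when it gives 0, [r >= 1] suffices. *)
pose e := (k * m - (s + 3) * m)%N.
have er : (2 ^ e <= r)%N.
  have [km|km] := leqP (k * m) ((s + 3) * m).
    by rewrite /e (eqP (_ : k * m - (s + 3) * m == 0)%N) ?subn_eq0.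
  rewrite -(@leq_pmul2r (2 ^ ((s + 3) * m))) ?expn_gt0 //.
  rewrite -expnD subnK ?(ltnW km) // (leq_trans kr) // leq_mul // expnM.
  by case: (m) => [|m'] //; rewrite leq_exp2r // kE square_le_expn.
(* Passing from [n] to a larger base needs the exponent to be nonnegative, which [d1] grants. *)
apply: (@le_trans _ _ ((2 ^ L.+1)%:R `^ (1 - delta n))).
  by rewrite ge0_ler_powR ?nnegrE ?ler0n ?ler_nat ?(ltnW nL) // subr_ge0 ltW.
rewrite [in leLHS]natrX -powR_mulrn // -powRrM.
apply: (@le_trans _ _ (2 `^ e%:R)); last first.
  by rewrite powR_mulrn // -natrX ler_nat.
rewrite ler_powR ?ler1n // mulrBr mulr1 lerBlDr /delta /harmonic -/s.
rewrite mulrA -(ler_pM2r (_ : 0 < s.+1%:R)) ?ltr0n // mulrDl divfK ?pnatr_eq0 //.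
rewrite -!natrM -natrD ler_nat.
by have := exponent_loss s0 kE mE sL; rewrite -/e !addn1; lia.
Qed.

End Exponents.

Theorem theorem1p4 (R : realType) :
  exists delta1 delta2 : nat -> R,
    [/\ forall n, 0 <= delta1 n,
        forall n, 0 <= delta2 n,
        delta1 @ \oo --> (0 : R),
        delta2 @ \oo --> (0 : R)
      & forall n : nat,
          exists (d : nat) (P : set 'rV[R]_d),
            [/\ polytope P,
                vertices P #<= `I_n,
                (affine_dim P)%:~R <= n%:R `^ delta1 n
              & n%:R `^ (1 - delta2 n) <= (xc P)%:R]].
Proof.
exists (@delta R), (@delta R); split; try exact: delta_ge0; try exact: cvg_delta.
case=> [|n].
  (* For [n = 0] the empty polytope serves: the exponent [1 - 16] is nonzero, so that power of 0 is
     0. *)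
  exists 0%N, (convex_hull (fun=> 0 : 'rV[R]_0) (k := 0)); split.
  - by eexists; eexists.
  - exact: vertices_card.
  - apply: le_trans (powR_ge0 _ _).
    by rewrite lerz0 (affine_dim_le _).
  - rewrite powR0 // /delta /loglog !trunc_log0 /harmonic /= invr1 mulr1.
    by rewrite subr_eq0 eq_sym pnatr_eq1.
(* If [loglog n.+1] is 0, then [k] is 0 and division by zero makes [m] 0; the bounds then ask for at
   most one vertex and [xc P >= 1]. *)
pose k := (loglog n.+1 ^ 2)%N; pose m := (trunc_log 2 n.+1 %/ k)%N.
have [d [P [Ppoly Pv Pdim Pxc]]] := low_dim_high_xc R k m.
exists d, P; split=> //.
- apply: card_le_trans Pv _; rewrite card_le_II.
  apply: leq_trans (trunc_logP (isT : 1 < 2)%N (isT : 0 < n.+1)%N).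
  by rewrite leq_exp2l // mulnC leq_trunc_div.
- apply: le_trans (dim_exponent R (leq_div _ k)).
  by rewrite [leRHS]pmulrn ler_int.
- exact: xc_exponent Pxc.
Qed.
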